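(* The nonunitary algebra $(\mathcal{H}^{\sqcup\!\sqcup}_{1,+},\ \sqcup\!\sqcup)$, together with the left multiplication operator $I_0:\mathcal{H}^{\sqcup\!\sqcup}_{1,+}\to\mathcal{H}^{\sqcup\!\sqcup}_{1,+}$, $I_0(w)=x_0w$, is the free commutative nonunitary Rota–Baxter $\mathbb{Q}$-algebra of weight $0$ generated by $x_1$. That is, $I_0$ is a Rota–Baxter operator of weight $0$, and for every commutative nonunitary Rota–Baxter $\mathbb{Q}$-algebra $(R,P)$ of weight $0$ and every $r\in R$ there is a unique homomorphism of nonunitary Rota–Baxter algebras $f:\mathcal{H}^{\sqcup\!\sqcup}_{1,+}\to R$ with $f(x_1)=r$.
   Context: A nonunitary Rota–Baxter $\mathbb{Q}$-algebra of weight $0$ is a pair $(R,P)$ where $R$ is a (not necessarily unital) $\mathbb{Q}$-algebra and $P:R\to R$ is $\mathbb{Q}$-linear with $P(x)P(y)=P(xP(y))+P(P(x)y)$ for all $x,y\in R$. A homomorphism $f:(R,P)\to(R',P')$ is an algebra homomorphism with $f\circ P=P'\circ f$. Let $\mathbb{Q}\langle x_0,x_1\rangle$ be the $\mathbb{Q}$-vector space with basis all words (including the empty word $1$) in the letters $x_0,x_1$, equipped with the shuffle product $\sqcup\!\sqcup$ defined recursively by $1\sqcup\!\sqcup w=w\sqcup\!\sqcup 1=w$ and $(au)\sqcup\!\sqcup(bv)=a(u\sqcup\!\sqcup bv)+b(au\sqcup\!\sqcup v)$ for letters $a,b$ and words $u,v$, extended bilinearly. Let $\mathcal{H}^{\sqcup\!\sqcup}_{1,+}=\mathbb{Q}\langle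 x_0,x_1\rangle x_1$ be the subspace spanned by the nonempty words ending in $x_1$, i.e. by $x_0^{u_1}x_1x_0^{u_2}x_1\cdots x_0^{u_k}x_1$ with $k\ge1$, $u_i\ge 0$; it is closed under $\sqcup\!\sqcup$. *)

(* Defs.v *)
From HB Require Import structures.
From mathcomp Require Import all_boot all_order all_algebra finmap.
From mathcomp.multinomials Require Import monalg.

Set Implicit Arguments.
Unset Strict Implicit.
Unset Printing Implicit Defensive.

Import GRing.Theory.
Local Open Scope ring_scope.

(* An algebra is a rational vector space R together with an operation mul,
   since MathComp has no algebras without unit. *)
Record comm_nualgebra (R : lmodType rat) (mul : R -> R -> R) : Prop :=
  CommNuAlgebra {
    nualg_mulA : associative mul;
    nualg_mulC : commutative mul;
    nualg_linearl : forall y, linear (mul^~ y);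
    nualg_linearr : forall x, linear (mul x)
  }.

(* All Rota-Baxter operators have weight 0. *)
Record RotaBaxter_operator (R : lmodType rat) (mul : R -> R -> R)
    (P : R -> R) : Prop :=
  RotaBaxterOperator {
    RB_linear : linear P;
    RB_eq : forall x y, mul (P x) (P y) = P (mul x (P y)) + P (mul (P x) y)
  }.

Record comm_nuRotaBaxter (R : lmodType rat) (mul : R -> R -> R)
    (P : R -> R) : Prop :=
  CommNuRotaBaxter {
    nuRB_algebra : comm_nualgebra mul;
    nuRB_operator : RotaBaxter_operator mul P
  }.

Record nuRotaBaxter_hom (R R' : lmodType rat)
    (mul : R -> R -> R) (P : R -> R) (mul' : R' -> R' -> R') (P' : R' -> R')
    (f : R -> R') : Prop :=
  NuRotaBaxterHom {
    nuRB_hom_linear : linear f;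
    nuRB_hom_mul : {morph f : x y / mul x y >-> mul' x y};
    nuRB_hom_op : forall x, f (P x) = P' (f x)
  }.

(* The letters x_0 and x_1 are encoded by the booleans false and true. *)
Notation word := {fmonom bool}.

(* The ring product * of this type is concatenation, not shuffle. *)
Notation ncpoly := {malg rat[word]}.

Definition letter (a : bool) : ncpoly := << fmu a >>.

Fixpoint shuffle_word (u : seq bool) : seq bool -> ncpoly :=
  if u is a :: u' then
    fix shuffle_u (v : seq bool) : ncpoly :=
      if v is b :: v' then
        letter a * shuffle_word u' v + letter b * shuffle_u v'
      else << FMonom u >>
  else fun v => << FMonom v >>.

Definition shuffle (p q : ncpoly) : ncpoly :=
  \sum_(u <- msupp p) \sum_(v <- msupp q)
    (p@_u * q@_v) *: shuffle_word u v.

(* Starting last at false = x_0 excludes the empty word. *)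
Definition ends_in_x1 (w : word) : bool := last false w.

Definition H1plus_pred : {pred ncpoly} :=
  fun p => all ends_in_x1 (msupp p).

Lemma H1plusP (p : ncpoly) :
  reflect (forall w, ~~ ends_in_x1 w -> p@_w = 0) (p \in H1plus_pred).
Proof.
apply: (iffP allP) => [pP w wN | pP w].
  by apply: mcoeff_outdom; apply: contra wN => /pP.
by rewrite -mcoeff_neq0; apply: contraR => /pP ->.
Qed.

Lemma H1plus_submod_closed : submod_closed H1plus_pred.
Proof.
split=> [|c p q /H1plusP pP /H1plusP qP]; apply/H1plusP => w wN.
  by rewrite mcoeff0.
by rewrite mcoeffD mcoeffZ pP // qP // mulr0 addr0.
Qed.

HB.instance Definition _ :=
  GRing.isSubmodClosed.Build rat ncpoly H1plus_pred H1plus_submod_closed.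

Record H1plus := MkH1plus {
  H1plus_val : ncpoly;
  H1plus_valP : H1plus_val \in H1plus_pred
}.

HB.instance Definition _ := [isSub for H1plus_val].
HB.instance Definition _ := [Choice of H1plus by <:].
HB.instance Definition _ := [SubChoice_isSubLmodule of H1plus by <:].

Lemma H1plus_monom (c : rat) (w : word) :
  ends_in_x1 w -> << c *g w >> \in H1plus_pred.
Proof.
move=> wP; apply/H1plusP => v vN; rewrite mcoeffU.
by case: eqP vN => // <-; rewrite wP.
Qed.

Lemma H1plus_letterM (a : bool) (p : ncpoly) :
  p \in H1plus_pred -> letter a * p \in H1plus_pred.
Proof.
move=> /allP pP; have -> : letter a * p =
  \sum_(k <- msupp p) << 1 * p@_k *g mmul (fmu a) k >> by exact: fgmulUg.
rewrite big_seq; apply: rpred_sum => k /pP kP; apply: H1plus_monom.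
by move: kP; rewrite /ends_in_x1 fmM fmU; case: (fmonom_val k).
Qed.

Lemma H1plus_shuffle_word (u v : seq bool) :
  last true u -> last true v -> (u != [::]) || (v != [::]) ->
  shuffle_word u v \in H1plus_pred.
Proof.
elim: u v => [|a u IHu] v uP vP uv0.
  by apply: H1plus_monom; case: v vP uv0.
elim: v vP uv0 => [|b v IHv] vP uv0; first exact: H1plus_monom.
apply: rpredD; apply: H1plus_letterM.
  by apply: IHu; rewrite ?orbT //; case: (u) uP.
by apply: IHv; rewrite //; case: (v) vP.
Qed.

Lemma H1plus_shuffle (p q : ncpoly) :
  p \in H1plus_pred -> q \in H1plus_pred -> shuffle p q \in H1plus_pred.
Proof.
have lastP (w : word) : ends_in_x1 w -> last true w /\ (w : seq bool) != [::].
  by case: w => -[|a w].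
move=> /allP pP /allP qP.
rewrite /shuffle big_seq; apply: rpred_sum => u /pP /lastP[uP u0].
rewrite big_seq; apply: rpred_sum => v /qP /lastP[vP _].
by apply/rpredZ/H1plus_shuffle_word; rewrite // u0.
Qed.

Definition H1plus_mul (p q : H1plus) : H1plus :=
  MkH1plus (H1plus_shuffle (H1plus_valP p) (H1plus_valP q)).

Definition I0 (p : H1plus) : H1plus :=
  MkH1plus (H1plus_letterM false (H1plus_valP p)).

Lemma H1plus_x1 : letter true \in H1plus_pred.
Proof. by apply: H1plus_monom; rewrite /ends_in_x1 fmU. Qed.

Definition x1 : H1plus := MkH1plus H1plus_x1.

(* Main.v *)
Require Import Defs.
From Stdlib Require Import FunctionalExtensionality.
From HB Require Import structures.
From mathcomp Require Import all_boot all_order all_algebra finmap.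
From mathcomp.multinomials Require Import monalg.

(** Write sh for the shuffle product and I1 for left multiplication by x1.
    From  x1 sh (x1^n x0 w) = (n+1) x1^(n+1) x0 w + x1^n x0 (x1 sh w)  and
    x1 sh x1^n = (n+1) x1^(n+1)  one sees, by induction on the number of leading
    letters x1, that H1plus is generated from x1 by linear combinations, I0 and
    x1 sh _; this gives uniqueness.  For existence, the same identities force
    f (x1^n) = r^n / n!  and  f (x1^n x0 w) = G_n (f w), where G_0 = P and
    (n+1) G_(n+1) z = r G_n z - G_n (r z).  The linear map so defined satisfies
    f (x1 sh y) = r f y  and  f (I0 y) = P (f y), and it is multiplicative by
    induction along the generation of both factors: for two factors I0 y and
    I0 z, apply the Rota-Baxter identity on both sides. *)

Set Implicit Arguments.
Unset Strict Implicit.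
Unset Printing Implicit Defensive.

Import GRing.Theory Num.Theory.
Local Open Scope ring_scope.

(** * Linear extension of maps defined on a basis *)

Lemma malgUZ (K : choiceType) (A : nzRingType) (c : A) (k : K) :
  << c *g k >> = c *: << k >>.
Proof. by apply/malgP => l; rewrite mcoeffZ !mcoeffU mulr_natr. Qed.

Section LinearExtension.
Variables (K : choiceType) (A : nzRingType).

Lemma malg_linear_ind (Q : {malg A[K]} -> Prop) :
  (forall k, Q << k >>) -> Q 0 ->
  (forall c p q, Q p -> Q q -> Q (c *: p + q)) ->
  forall p, Q p.
Proof.
move=> Q1 Q0 Qlin p; rewrite [p]monalgE; elim: (X in bigop _ X) => [|k s IHs].
  by rewrite big_nil.
by rewrite big_cons malgUZ; apply: Qlin.
Qed.

Variables (V : lmodType A) (h : K -> V).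

Definition malg_lin (p : {malg A[K]}) : V := \sum_(k <- msupp p) p@_k *: h k.

Lemma malg_lin_sub (d : {fset K}) (p : {malg A[K]}) :
  (msupp p `<=` d)%fset -> malg_lin p = \sum_(k <- d) p@_k *: h k.
Proof.
move=> pd; rewrite /malg_lin; apply: big_fset_incl => // k _ /mcoeff_outdom ->.
by rewrite scale0r.
Qed.

Lemma malg_lin_is_linear : linear malg_lin.
Proof.
(* The three sums run over different supports; all are rewritten over one common finite set. *)
move=> c p q; pose d := (msupp (c *: p + q) `|` msupp p `|` msupp q)%fset.
rewrite !(@malg_lin_sub d); first last.
- by rewrite /d -fsetUA fsubsetUl.
- by rewrite /d fsetUAC fsubsetUr.
- exact: fsubsetUr.
rewrite scaler_sumr -big_split /=; apply: eq_bigr => k _.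
by rewrite mcoeffD mcoeffZ scalerDl scalerA.
Qed.

HB.instance Definition _ :=
  GRing.isLinear.Build A {malg A[K]} V *:%R malg_lin malg_lin_is_linear.

Lemma malg_linU k : malg_lin << k >> = h k.
Proof.
by rewrite (malg_lin_sub msuppU_le) big_seq_fset1 mcoeffUU scale1r.
Qed.

End LinearExtension.

(** * The shuffle algebra on all words *)

(* [monom], [lcons] and [sh] are locked: otherwise unification unfolds
   finitely supported functions and rewriting does not terminate in practice. *)
HB.lock Definition monom (u : seq bool) : ncpoly := << FMonom u >>.

Lemma ncpoly_linear_ind (Q : ncpoly -> Prop) :
  (forall u, Q (monom u)) -> Q 0 ->
  (forall c p q, Q p -> Q q -> Q (c *: p + q)) ->
  forall p, Q p.
Proof.
by move=> Qm; apply: malg_linear_ind => -[u]; have := Qm u; rewrite monom.unlock.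
Qed.

HB.lock Definition lcons (a : bool) (p : ncpoly) : ncpoly := letter a * p.

Lemma lcons_monom (a : bool) (u : seq bool) : lcons a (monom u) = monom (a :: u).
Proof.
rewrite lcons.unlock monom.unlock /letter [LHS]fgmulUU mulr1; congr (<< _ *g _ >>).
by apply/eqP; rewrite fmP fmM fmU.
Qed.

Lemma lcons_linear (a : bool) : linear (lcons a).
Proof.
have lconsE p : lcons a p = malg_lin (fun k : word => << mmul (fmu a) k >>) p.
  rewrite lcons.unlock [LHS]fgmulUg; apply: eq_bigr => k _.
  by rewrite mul1r malgUZ.
by move=> c p q; rewrite !lconsE linearP.
Qed.

HB.instance Definition _ (a : bool) :=
  GRing.isLinear.Build rat ncpoly ncpoly *:%R (lcons a) (lcons_linear a).

HB.lock Definition sh (p q : ncpoly) : ncpoly := shuffle p q.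

Lemma shuffleE (p q : ncpoly) :
  sh p q =
  malg_lin (fun u : word => malg_lin (fun v : word => shuffle_word u v) q) p.
Proof.
rewrite sh.unlock; apply: eq_bigr => u _; rewrite scaler_sumr; apply: eq_bigr => v _.
by rewrite scalerA.
Qed.

Lemma shuffle_linearr (p : ncpoly) : linear (sh p).
Proof.
move=> c q r; rewrite !shuffleE /malg_lin scaler_sumr -big_split.
apply: eq_bigr => u _ /=; rewrite -!/(malg_lin _ _) linearP scalerDr !scalerA.
by rewrite mulrC.
Qed.

HB.instance Definition _ (p : ncpoly) :=
  GRing.isLinear.Build rat ncpoly ncpoly *:%R (sh p) (shuffle_linearr p).

Lemma shuffle_linearl (q : ncpoly) : linear (sh^~ q).
Proof. by move=> c p r; rewrite !shuffleE linearP. Qed.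

Lemma shuffle0p : left_zero 0 sh.
Proof. by move=> q; rewrite shuffleE linear0. Qed.

Lemma shuffleDl : left_distributive sh +%R.
Proof. by move=> p r q; rewrite !shuffleE linearD. Qed.

Lemma shuffle_monom u v : sh (monom u) (monom v) = shuffle_word u v.
Proof. by rewrite shuffleE monom.unlock !malg_linU. Qed.

Lemma shuffle_word_cons a b u v :
  shuffle_word (a :: u) (b :: v) =
  lcons a (shuffle_word u (b :: v)) + lcons b (shuffle_word (a :: u) v).
Proof. by rewrite lcons.unlock. Qed.

Lemma shuffle1p : left_id (monom [::]) sh.
Proof.
elim/ncpoly_linear_ind => [u||c p q IHp IHq]; first by rewrite shuffle_monom monom.unlock.
  by rewrite linear0.
by rewrite shuffle_linearr IHp IHq.
Qed.

(** The letter recursion, freed from words by bilinearity; the later shuffle identities rest on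
    it. *)
Lemma shuffle_lcons (a b : bool) (p q : ncpoly) :
  sh (lcons a p) (lcons b q) =
  lcons a (sh p (lcons b q)) + lcons b (sh (lcons a p) q).
Proof.
elim/ncpoly_linear_ind: p => [u||c p p' IHp IHp'].
- elim/ncpoly_linear_ind: q => [v||c q q' IHq IHq'].
  + by rewrite !lcons_monom !shuffle_monom shuffle_word_cons.
  + by rewrite !linear0 addr0.
  + rewrite lcons_linear !shuffle_linearr IHq IHq' !lcons_linear.
    by rewrite scalerDr addrACA.
- by rewrite linear0 !shuffle0p !linear0 addr0.
- rewrite lcons_linear !shuffle_linearl IHp IHp' !lcons_linear.
  by rewrite scalerDr addrACA.
Qed.

Lemma shuffleC : commutative sh.
Proof.
elim/ncpoly_linear_ind => [u||c p p' IHp IHp'] q; first last.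
- by rewrite shuffle_linearl shuffle_linearr IHp IHp'.
- by rewrite linear0 shuffle0p.
elim/ncpoly_linear_ind: q => [v||c q q' IHq IHq']; first last.
- by rewrite shuffle_linearl shuffle_linearr IHq IHq'.
- by rewrite linear0 shuffle0p.
rewrite !shuffle_monom; elim: u v => [|a u IHu]; first by case; rewrite /= ?monom.unlock.
elim=> [//|b v IHv]; rewrite !shuffle_word_cons addrC.
by rewrite IHv IHu.
Qed.

Lemma shufflep1 : right_id (monom [::]) sh.
Proof. by move=> p; rewrite shuffleC shuffle1p. Qed.

Lemma shuffleA : associative sh.
Proof.
elim/ncpoly_linear_ind => [u||c p p' IHp IHp'] q r; first last.
- by rewrite !shuffle_linearl IHp IHp'.
- by rewrite !shuffle0p.
elim/ncpoly_linear_ind: q => [v||c q q' IHq IHq']; first last.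
- by rewrite shuffle_linearl !shuffle_linearr shuffle_linearl IHq IHq'.
- by rewrite linear0 !shuffle0p linear0.
elim/ncpoly_linear_ind: r => [w||c r r' IHr IHr']; first last.
- by rewrite !shuffle_linearr IHr IHr'.
- by rewrite !linear0.
elim: u v w => [|a u IHu] v w; first by rewrite !shuffle1p.
elim: v w => [|b v IHv] w; first by rewrite shufflep1 shuffle1p.
elim: w => [|c w IHw]; first by rewrite !shufflep1.
have {}IHu := IHu (b :: v) (c :: w); have {}IHv := IHv (c :: w).
(* Each hypothesis drops the first letter of one factor. The tails become arbitrary polynomials so
   that [shuffle_lcons] applies to products as well. *)
move: IHu IHv IHw; rewrite -!lcons_monom.
move: (monom u) (monom v) (monom w) => p q r IHp IHq IHr.
(* Both bracketings are sorted by which of the three factors supplies the first letter. *)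
transitivity (lcons a (sh p (sh (lcons b q) (lcons c r))) +
  (lcons b (sh (lcons a p) (sh q (lcons c r))) +
   lcons c (sh (lcons a p) (sh (lcons b q) r)))).
  rewrite [sh (lcons b q) (lcons c r)]shuffle_lcons !linearD /= !shuffle_lcons.
  by rewrite addrACA.
rewrite IHp IHq IHr [sh (lcons a p) (lcons b q)]shuffle_lcons !shuffleDl.
by rewrite !shuffle_lcons !linearD /= -!addrA; congr (_ + _); rewrite addrCA.
Qed.

(** * The Rota-Baxter algebra of words ending in x1 *)

Lemma H1plus_val_inj : injective H1plus_val.
Proof. exact: val_inj. Qed.

Lemma H1plus_val_linear : linear H1plus_val.
Proof. by move=> c p q; rewrite -[H1plus_val]/(val : H1plus -> _) linearP. Qed.

Lemma H1plus_val_mul p q :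
  H1plus_val (H1plus_mul p q) = sh (H1plus_val p) (H1plus_val q).
Proof. by rewrite sh.unlock. Qed.

Lemma H1plus_val_I0 p : H1plus_val (I0 p) = lcons false (H1plus_val p).
Proof. by rewrite lcons.unlock. Qed.

Definition I1 (p : H1plus) : H1plus :=
  MkH1plus (H1plus_letterM true (H1plus_valP p)).

Lemma H1plus_val_I1 p : H1plus_val (I1 p) = lcons true (H1plus_val p).
Proof. by rewrite lcons.unlock. Qed.

Lemma H1plus_val_x1 : H1plus_val x1 = monom [:: true].
Proof. by rewrite monom.unlock /= /letter fmuE. Qed.

Lemma I0_linear : linear I0.
Proof.
move=> c p q; apply: H1plus_val_inj.
by rewrite !(H1plus_val_linear, H1plus_val_I0) linearP.
Qed.

Lemma I1_linear : linear I1.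
Proof.
move=> c p q; apply: H1plus_val_inj.
by rewrite !(H1plus_val_linear, H1plus_val_I1) linearP.
Qed.

Lemma H1plus_mulC : commutative H1plus_mul.
Proof.
by move=> p q; apply: H1plus_val_inj; rewrite !H1plus_val_mul shuffleC.
Qed.

Lemma H1plus_mulA : associative H1plus_mul.
Proof.
by move=> p q r; apply: H1plus_val_inj; rewrite !H1plus_val_mul shuffleA.
Qed.

Lemma H1plus_mul_linearr p : linear (H1plus_mul p).
Proof.
move=> c q r; apply: H1plus_val_inj.
by rewrite !(H1plus_val_linear, H1plus_val_mul) shuffle_linearr.
Qed.

Lemma H1plus_mul_linearl q : linear (H1plus_mul^~ q).
Proof. by move=> c p r; rewrite !(H1plus_mulC _ q) H1plus_mul_linearr. Qed.

HB.instance Definition _ := GRing.isLinear.Build rat H1plus H1plus *:%R I0 I0_linear.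
HB.instance Definition _ := GRing.isLinear.Build rat H1plus H1plus *:%R I1 I1_linear.
HB.instance Definition _ p :=
  GRing.isLinear.Build rat H1plus H1plus *:%R (H1plus_mul p) (H1plus_mul_linearr p).

Lemma H1plus_valD p q : H1plus_val (p + q) = H1plus_val p + H1plus_val q.
Proof. by have := H1plus_val_linear 1 p q; rewrite !scale1r. Qed.

(** The Rota-Baxter identity is the shuffle recursion with both first letters equal to x0. *)
Lemma I0_RotaBaxter : RotaBaxter_operator H1plus_mul I0.
Proof.
split=> [|p q]; first exact: I0_linear.
apply: H1plus_val_inj; rewrite H1plus_valD.
by rewrite !(H1plus_val_I0, H1plus_val_mul) shuffle_lcons.
Qed.

Lemma H1plus_nuRotaBaxter : comm_nuRotaBaxter H1plus_mul I0.
Proof.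
split; last exact: I0_RotaBaxter.
split; [exact: H1plus_mulA | exact: H1plus_mulC | |].
- exact: H1plus_mul_linearl.
- exact: H1plus_mul_linearr.
Qed.

(** * Shuffling with x1, and generation of the algebra from x1 *)

Lemma x1_mul_I1 p : H1plus_mul x1 (I1 p) = I1 (I1 p) + I1 (H1plus_mul x1 p).
Proof.
apply: H1plus_val_inj; rewrite H1plus_valD !(H1plus_val_I1, H1plus_val_mul).
by rewrite H1plus_val_x1 -!lcons_monom shuffle_lcons shuffle1p.
Qed.

Lemma x1_mul_I0 p : H1plus_mul x1 (I0 p) = I1 (I0 p) + I0 (H1plus_mul x1 p).
Proof.
apply: H1plus_val_inj.
rewrite H1plus_valD !(H1plus_val_I0, H1plus_val_I1, H1plus_val_mul).
by rewrite H1plus_val_x1 -!lcons_monom shuffle_lcons shuffle1p.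
Qed.

Lemma x1_mul_x1 : H1plus_mul x1 x1 = I1 x1 *+ 2.
Proof.
apply: H1plus_val_inj; rewrite mulr2n H1plus_valD H1plus_val_I1 H1plus_val_mul.
by rewrite H1plus_val_x1 -!lcons_monom shuffle_lcons shuffle1p shufflep1.
Qed.

Lemma H1plus_word_ind (Q : H1plus -> Prop) :
  (forall c p q, Q p -> Q q -> Q (c *: p + q)) ->
  Q x1 -> (forall p, Q p -> Q (I0 p)) -> (forall p, Q p -> Q (I1 p)) ->
  forall p, Q p.
Proof.
move=> Qlin Qx1 QI0 QI1 p.
have Q0 : Q 0 by rewrite -(addNr x1) -scaleN1r; apply: Qlin.
have Qword (w : seq bool) :
    last false w -> exists2 q, H1plus_val q = monom w & Q q.
  (* A one-letter word must be x1, so the recursion stops there and never meets the empty word. *)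
  elim: w => [//|a [|b w] IHw] wP.
    by exists x1 => //; rewrite H1plus_val_x1; case: (a) wP.
  have [q qE Qq] := IHw wP; rewrite -lcons_monom -qE.
  case: a {IHw wP}.
    by exists (I1 q); [exact: H1plus_val_I1 | exact: QI1].
  by exists (I0 q); [exact: H1plus_val_I0 | exact: QI0].
(* [Q] speaks of the subtype only, so every partial sum of the expansion is lifted to an element of
   [H1plus]. *)
have Qsum (s : seq word) : all ends_in_x1 s ->
    exists2 q, H1plus_val q = \sum_(w <- s) << (H1plus_val p)@_w *g w >> & Q q.
  elim: s => [_|[w] s IHs /andP[wP sP]]; first by exists 0; rewrite ?big_nil.
  have [q qE Qq] := IHs sP; have [q' qE' Qq'] := Qword w wP.
  exists ((H1plus_val p)@_(FMonom w) *: q' + q); last exact: Qlin.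
  by rewrite H1plus_val_linear big_cons qE qE' [in RHS]malgUZ monom.unlock.
have [q qE Qq] := Qsum _ (H1plus_valP p).
by rewrite -(H1plus_val_inj (etrans qE (esym (monalgE _)))).
Qed.

(** [iter n I1 x1] is the word x1^(n+1), whence the coefficient n+2. *)
Lemma x1_mul_iterI1_x1 n :
  H1plus_mul x1 (iter n I1 x1) = iter n.+1 I1 x1 *+ n.+2.
Proof.
elim: n => [|n IHn]; first exact: x1_mul_x1.
by rewrite iterS x1_mul_I1 IHn raddfMn -mulrS.
Qed.

Lemma x1_mul_iterI1_I0 n p :
  H1plus_mul x1 (iter n I1 (I0 p)) =
  iter n.+1 I1 (I0 p) *+ n.+1 + iter n I1 (I0 (H1plus_mul x1 p)).
Proof.
elim: n => [|n IHn]; first exact: x1_mul_I0.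
by rewrite iterS x1_mul_I1 IHn raddfD raddfMn addrA -mulrS.
Qed.

(** Unlike [I1], the operations [I0] and shuffling with x1 are respected by every homomorphism, so
    this principle suits statements about homomorphisms. *)
Lemma H1plus_shuffle_ind (Q : H1plus -> Prop) :
  (forall c p q, Q p -> Q q -> Q (c *: p + q)) ->
  Q x1 -> (forall p, Q p -> Q (I0 p)) ->
  (forall p, Q p -> Q (H1plus_mul x1 p)) ->
  forall p, Q p.
Proof.
move=> Qlin Qx1 QI0 Qmul p.
have Q0 : Q 0 by rewrite -(addNr x1) -scaleN1r; apply: Qlin.
(* Division by n+1 is where rational coefficients enter. *)
have Qdiv n q : Q (q *+ n.+1) -> Q q.
  move=> Qq; have -> : q = (n.+1%:R)^-1 *: (q *+ n.+1) + 0.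
    by rewrite addr0 -scaler_nat scalerA mulVf ?scale1r // pnatr_eq0.
  exact: Qlin.
(* [q] stays general: the step for n+1 uses the hypothesis at x1 shuffled with [q]. *)
have Qiter_I0 n : forall q, Q q -> Q (iter n I1 (I0 q)).
  elim: n => [|n IHn] q Qq; first exact: QI0.
  apply: (Qdiv n); rewrite -[X in Q X](addrK (iter n I1 (I0 (H1plus_mul x1 q)))).
  rewrite -x1_mul_iterI1_I0 addrC -scaleN1r.
  by apply: Qlin; [apply/IHn/Qmul | apply/Qmul/IHn].
(* With all n at once, a leading x1 is absorbed by passing from n to n+1. *)
suff: forall n, Q (iter n I1 p) by apply: (fun h => h 0%N).
elim/H1plus_word_ind: p => [c p q Qp Qq n||p Qp n|p Qp n].
- suff -> : iter n I1 (c *: p + q) = c *: iter n I1 p + iter n I1 q by exact: Qlin.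
  by elim: n => [//|n IHn]; rewrite !iterS IHn linearP.
- elim=> [//|n IHn]; apply: (Qdiv n.+1).
  by rewrite -x1_mul_iterI1_x1; apply: Qmul.
- exact/Qiter_I0/(Qp 0%N).
- by rewrite -iterSr.
Qed.

(** * Existence of the homomorphism *)

Lemma malg_lin_lcons (V : lmodType rat) (h h' : word -> V) (g : V -> V) a p :
  linear g -> (forall w, h (FMonom (a :: w)) = g (h' (FMonom w))) ->
  malg_lin h (lcons a p) = g (malg_lin h' p).
Proof.
move=> g_lin hE; have g0 : g 0 = 0.
  by have := g_lin (-1) 0 0; rewrite scaler0 addr0 scaleN1r addNr.
elim/ncpoly_linear_ind: p => [w||c p q IHp IHq].
- by rewrite lcons_monom monom.unlock !malg_linU.
- by rewrite !linear0 g0.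
- by rewrite lcons_linear !malg_lin_is_linear g_lin IHp IHq.
Qed.

Section Universal.
Variables (R : lmodType rat) (mul : R -> R -> R) (P : R -> R).
Hypothesis RB : comm_nuRotaBaxter mul P.
Variable r : R.

Let algR := nuRB_algebra RB.
Let mulA : associative mul := nualg_mulA algR.
Let mulC : commutative mul := nualg_mulC algR.
Let mul_linearl := nualg_linearl algR.
Let mul_linearr := nualg_linearr algR.
Let P_linear : linear P := RB_linear (nuRB_operator RB).

(* [divpow n] is r^(n+1) / (n+1)!, as r^0 does not exist in R. *)
Fixpoint divpow (n : nat) : R :=
  if n is m.+1 then n.+1%:R^-1 *: mul r (divpow m) else r.

(* [divpowP n (f w)] is the value of f at x1^n x0 w. *)
Fixpoint divpowP (n : nat) (z : R) : R :=
  if n is m.+1 then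
    n%:R^-1 *: (mul r (divpowP m z) - divpowP m (mul r z))
  else P z.

(* [lift_word n w] is the value of f at x1^n w; it is junk for the empty
   word, when n = 0. *)
Fixpoint lift_word (n : nat) (w : seq bool) : R :=
  match w with
  | [::] => divpow n.-1
  | true :: w' => lift_word n.+1 w'
  | false :: w' => divpowP n (lift_word 0 w')
  end.

(** The homomorphism is [lift 0]; the other n record a block of leading x1 already read. *)
Definition lift (n : nat) (p : H1plus) : R :=
  malg_lin (fun w : word => lift_word n w) (H1plus_val p).

Lemma lift_linear n : linear (lift n).
Proof. by move=> c p q; rewrite /lift H1plus_val_linear linearP. Qed.

HB.instance Definition _ n :=
  GRing.isLinear.Build rat H1plus R *:%R (lift n) (lift_linear n).

Lemma divpowP_linear n : linear (divpowP n).
Proof.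
elim: n => [|n IHn] c y z; first exact: P_linear.
rewrite /= IHn !mul_linearr IHn scalerA mulrC -scalerA -scalerDr scalerBr.
by rewrite opprD addrACA.
Qed.

Lemma lift_x1 n : lift n x1 = divpow n.
Proof. by rewrite /lift H1plus_val_x1 monom.unlock malg_linU. Qed.

Lemma lift_I1 n p : lift n (I1 p) = lift n.+1 p.
Proof.
rewrite /lift H1plus_val_I1.
exact: (@malg_lin_lcons R _ (fun w : word => lift_word n.+1 w) idfun).
Qed.

Lemma lift_I0 n p : lift n (I0 p) = divpowP n (lift 0 p).
Proof.
rewrite /lift H1plus_val_I0; apply: malg_lin_lcons => //.
exact: divpowP_linear.
Qed.

Lemma divpowS n : divpow n.+1 *+ n.+2 = mul r (divpow n).
Proof. by rewrite -scaler_nat scalerA mulfV ?scale1r ?pnatr_eq0. Qed.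

Lemma divpowPS n z :
  divpowP n.+1 z *+ n.+1 = mul r (divpowP n z) - divpowP n (mul r z).
Proof. by rewrite -scaler_nat scalerA mulfV ?scale1r ?pnatr_eq0. Qed.

(** This is the image under [lift 0] of x1 sh (x1^n p) = n x1^(n+1) p + x1^n (x1 sh p). Only n = 0
    is wanted, but the [I1] case raises n. *)
Lemma lift_x1_mul_aux n p :
  lift n.+1 p *+ n + lift n (H1plus_mul x1 p) = mul r (lift n p).
Proof.
elim/H1plus_word_ind: p n => [c p q IHp IHq n|n|p IHp n|p IHp n].
- rewrite H1plus_mul_linearr !lift_linear mul_linearr -IHp -IHq.
  by rewrite mulrnDl scalerMnr scalerDr addrACA.
- by rewrite x1_mul_x1 raddfMn /= lift_I1 !lift_x1 -mulrnDr addn2 divpowS.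
- rewrite x1_mul_I0 raddfD /= lift_I1 !lift_I0 addrA -mulrSr divpowPS.
  (* At n = 0 the hypothesis says that [lift 0] turns shuffling [p] with x1 into multiplication by
     [r], which cancels the subtracted term of [divpowPS]. *)
  by have /= <- := IHp 0%N; rewrite add0r subrK.
- by rewrite x1_mul_I1 raddfD /= !lift_I1 addrA -mulrSr IHp.
Qed.

Lemma lift_x1_mul p : lift 0 (H1plus_mul x1 p) = mul r (lift 0 p).
Proof. by rewrite -lift_x1_mul_aux mulr0n add0r. Qed.

Lemma lift_mul p q : lift 0 (H1plus_mul p q) = mul (lift 0 p) (lift 0 q).
Proof.
elim/H1plus_shuffle_ind: p q => [c p p' IHp IHp'||p IHp|p IHp] q.
- by rewrite H1plus_mul_linearl !lift_linear mul_linearl IHp IHp'.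
- by rewrite lift_x1_mul lift_x1.
- elim/H1plus_shuffle_ind: q => [c q q' IHq IHq'||q IHq|q IHq].
  + by rewrite H1plus_mul_linearr !lift_linear mul_linearr IHq IHq'.
  + by rewrite H1plus_mulC lift_x1_mul lift_x1 mulC.
  (* Of the two summands, [p] times [I0 q] falls to the outer hypothesis and [I0 p] times [q] to the
     inner one. *)
  + rewrite (RB_eq I0_RotaBaxter) raddfD /= !lift_I0 IHp IHq !lift_I0 /=.
    by rewrite (RB_eq (nuRB_operator RB)).
  + rewrite H1plus_mulA (H1plus_mulC _ x1) -H1plus_mulA !lift_x1_mul IHq.
    by rewrite !mulA (mulC r).
- by rewrite -H1plus_mulA !lift_x1_mul IHp mulA.
Qed.

Lemma lift_hom : nuRotaBaxter_hom H1plus_mul I0 mul P (lift 0).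
Proof.
split; [exact: lift_linear | exact: lift_mul | exact: lift_I0].
Qed.

End Universal.

(** * Uniqueness and the universal property *)

Lemma nuRotaBaxter_hom_unique (R : lmodType rat) (mul : R -> R -> R)
    (P : R -> R) (f g : H1plus -> R) :
  nuRotaBaxter_hom H1plus_mul I0 mul P f ->
  nuRotaBaxter_hom H1plus_mul I0 mul P g -> f x1 = g x1 -> f =1 g.
Proof.
move=> [f_lin f_mul f_op] [g_lin g_mul g_op] fgx1.
elim/H1plus_shuffle_ind => [c p q IHp IHq||p IHp|p IHp] //.
- by rewrite f_lin g_lin IHp IHq.
- by rewrite f_op g_op IHp.
- by rewrite f_mul g_mul fgx1 IHp.
Qed.

Theorem theorem2p9 :
  comm_nuRotaBaxter H1plus_mul I0 /\
  forall (R : lmodType rat) (mul : R -> R -> R) (P : R -> R),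
    comm_nuRotaBaxter mul P ->
    forall r : R,
      exists! f : H1plus -> R,
        nuRotaBaxter_hom H1plus_mul I0 mul P f /\ f x1 = r.
Proof.
split=> [|R mul P RB r]; first exact: H1plus_nuRotaBaxter.
exists (lift mul P r 0); split=> [|g [g_hom gx1]].
  by split; [exact: lift_hom | rewrite lift_x1].
(* Unique existence compares maps by equality, while uniqueness was proved pointwise. *)
apply: functional_extensionality => p.
by apply: nuRotaBaxter_hom_unique (lift_hom RB r) g_hom _ p; rewrite gx1 lift_x1.
Qed.
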